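(* For $m\ge1$, sample a meander uniformly at random from the set of all (open) meanders of size $m$. Conditioned on its winding function $\theta:\{1,\dots,2m-1\}\to\mathbb R$, the (oriented) arc diagrams of the meander above and below $\mathbb R$ are conditionally independent.
   Context: An (open) meander of size $m$ is a self-avoiding loop from $\infty$ to $\infty$ in $\mathbb C\cup\{\infty\}$ which intersects $\mathbb R$ exactly at the points $1,2,\dots,2m-1$, crossing transversally at each, viewed modulo homeomorphisms $f:\mathbb C\to\mathbb C$ with $f(\mathbb H)=\mathbb H$ ($\mathbb H$ the upper half-plane) and $f(i)=i$ for $i\in\{1,\dots,2m-1\}$. It is encoded by a pair of arc diagrams (non-crossing perfect matchings) on $\{1,\dots,2m-1\}\cup\{\infty\}$, one drawn above and the other below $\mathbb R$. Orient the meander so that it starts at $\infty$ in the lower half-plane and ends at $\infty$ in the upper half-plane; each arc inherits an orientation. Winding function: let $v_1,\dots,v_{2m-1}$ be the points of $\{1,\dots,2m-1\}$ in the order in which the oriented curve visits them. Set $\theta(v_1)=0$ and inductively $\theta(v_{i+1})=\theta(v_i)+\pi$ if the arc from $v_i$ to $v_{i+1}$ is traversed counterclockwise, and $\theta(v_{i+1})=\theta(v_i)-\pi$ otherwise. *)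

(* Defs.v *)
From mathcomp Require Import all_boot all_order all_algebra.
From mathcomp Require Import reals trigo.

Set Implicit Arguments.
Unset Strict Implicit.
Unset Printing Implicit Defensive.

Import Order.TTheory GRing.Theory Num.Theory.
Local Open Scope ring_scope.

(* The points 1, ..., 2m-1 of the real line, and the point at infinity.
   [Some i] stands for the integer i + 1 and [None] for infinity. *)
Notation realpt m := 'I_(m.*2.-1).
Notation point m := (option (realpt m)).

(* Left-to-right position on the line, infinity being put at the right end:
   an arc from i to infinity crosses exactly the arcs joining a point on the
   left of i to a (finite) point on the right of i. *)
Definition pos (m : nat) (x : point m) : nat :=
  if x is Some i then nat_of_ord i else m.*2.-1.

(* A perfect matching is encoded by the map sending each point to its partner,
   i.e. a fixed-point-free involution. *)
Definition perfect_matching (m : nat) (d : {ffun point m -> point m}) : bool :=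
  [forall x, (d x != x) && (d (d x) == x)].

Definition noncrossing (m : nat) (d : {ffun point m -> point m}) : bool :=
  [forall x, forall y,
     ~~ [&& pos x < pos y, pos y < pos (d x) & pos (d x) < pos (d y)]%N].

Definition arc_diagram (m : nat) (d : {ffun point m -> point m}) : bool :=
  perfect_matching d && noncrossing d.

(* The curve obtained by gluing the arcs of [up] (above the line) and [lo]
   (below the line), followed from infinity into the lower half-plane:
   [visit up lo 0] is infinity and [visit up lo i] is the i-th point v_i.
   The arc from v_i to v_(i+1) lies above the line iff i is odd. *)
Fixpoint visit (m : nat) (up lo : {ffun point m -> point m}) (i : nat) :
    point m :=
  if i is j.+1 then (if odd j then up else lo) (visit up lo j) else None.

(* Infinity together with v_1, ..., v_(2m-1). *)
Definition itinerary (m : nat) (up lo : {ffun point m -> point m}) :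
    seq (point m) :=
  mkseq (visit up lo) m.*2.

(* The arcs form a single loop, which passes through infinity and all of
   1, ..., 2m-1 (rather than several disjoint components). *)
Definition single_loop (m : nat) (up lo : {ffun point m -> point m}) : bool :=
  [forall x, x \in itinerary up lo].

(* Homeomorphism classes of open meanders of size m, through their encoding by
   the arc diagrams above ([.1]) and below ([.2]) the real line. *)
Definition meander (m : nat) : Type :=
  {d : {ffun point m -> point m} * {ffun point m -> point m} |
     [&& arc_diagram d.1, arc_diagram d.2 & single_loop d.1 d.2]}.

Definition upper (m : nat) (M : meander m) : {ffun point m -> point m} :=
  (val M).1.
Definition lower (m : nat) (M : meander m) : {ffun point m -> point m} :=
  (val M).2.

Definition vtx (m : nat) (M : meander m) (i : nat) : point m :=
  visit (upper M) (lower M) i.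

(* An oriented arc diagram is the set of its arcs (source, target). The last
   arc of the curve goes from [vtx M (2m-1)] to [vtx M (2m)], which is
   infinity. *)
Definition oriented_upper (m : nat) (M : meander m) :
    {set point m * point m} :=
  [set (vtx M i, vtx M i.+1) | i : 'I_(m.*2) & odd i].
Definition oriented_lower (m : nat) (M : meander m) :
    {set point m * point m} :=
  [set (vtx M i, vtx M i.+1) | i : 'I_(m.*2) & ~~ odd i].

(* Above the line, counterclockwise means from right to left; below the line,
   from left to right. *)
Definition counterclockwise (m : nat) (M : meander m) (i : nat) : bool :=
  if odd i then (pos (vtx M i.+1) < pos (vtx M i))%N
  else (pos (vtx M i) < pos (vtx M i.+1))%N.

(* [angle R M k] is theta(v_(k+1)). *)
Fixpoint angle (R : realType) (m : nat) (M : meander m) (k : nat) : R :=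
  if k is j.+1 then
    angle R M j + (if counterclockwise M k then pi else - pi)
  else 0.

Definition winding (R : realType) (m : nat) (M : meander m) :
    {ffun realpt m -> R} :=
  [ffun p => angle R M (index (Some p) (itinerary (upper M) (lower M))).-1].

Lemma itinerary_uniq (m : nat) (M : meander m) :
  (0 < m)%N -> uniq (itinerary (upper M) (lower M)).
Proof.
move=> m_gt0; have /and3P[_ _ /forallP sl] := valP M.
have sub : {subset enum {: point m} <= itinerary (upper M) (lower M)}.
  by move=> x _; apply: sl.
apply: (leq_size_uniq (enum_uniq _) sub).
by rewrite size_mkseq -cardT /= card_option card_ord prednK ?double_gt0.
Qed.

Lemma index_itinerary (m : nat) (M : meander m) (i : nat) :
  (i < m.*2)%N -> index (vtx M i) (itinerary (upper M) (lower M)) = i.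
Proof.
move=> lt_i; have m_gt0 : (0 < m)%N by case: m M lt_i.
have <- : nth None (itinerary (upper M) (lower M)) i = vtx M i.
  by rewrite nth_mkseq.
by rewrite index_uniq ?size_mkseq ?itinerary_uniq.
Qed.

Lemma vtx_inj (m : nat) (M : meander m) (i j : nat) :
  (i < m.*2)%N -> (j < m.*2)%N -> vtx M i = vtx M j -> i = j.
Proof.
by move=> lt_i lt_j eq_ij; rewrite -(index_itinerary M lt_i) eq_ij index_itinerary.
Qed.

Lemma vtx_last (m : nat) (M : meander m) : (0 < m)%N -> vtx M m.*2 = None.
Proof.
move=> m_gt0; have [k mE] : exists k, m.*2 = k.*2.+2.
  by exists m.-1; rewrite -doubleS prednK.
have /and3P[/andP[/forallP pmU _] _ /forallP sl] := valP M.
have upK x : upper M (upper M x) = x by have /andP[_ /eqP] := pmU x.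
have up_neq x : upper M x != x by have /andP[] := pmU x.
have lastE : vtx M m.*2 = upper M (vtx M k.*2.+1).
  by apply: etrans (congr1 (vtx M) mE) _; rewrite /vtx /= odd_double.
have lt_last : (k.*2.+1 < m.*2)%N by rewrite mE.
have /(nthP None)[j] := sl (vtx M m.*2).
rewrite size_mkseq => lt_j; rewrite nth_mkseq // -/(vtx M j) => jE.
case: j lt_j jE => [|j] lt_j jE; first by rewrite -jE.
have upE : upper M (vtx M j.+1) = vtx M k.*2.+1.
  by rewrite [vtx M j.+1]jE lastE upK.
case odd_j: (odd j).
  have vE : vtx M j.+1 = upper M (vtx M j) by rewrite {1}/vtx /= odd_j.
  have := upE; rewrite vE upK => /(vtx_inj (ltnW lt_j) lt_last) j_eq.
  by exfalso; move: lt_j; rewrite j_eq mE ltnn.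
have vE : vtx M j.+2 = upper M (vtx M j.+1) by rewrite /vtx /= odd_j.
have [lt_j2|] := ltnP j.+2 m.*2.
  have := upE; rewrite -vE => /(vtx_inj lt_j2 lt_last) /(congr1 odd).
  by rewrite /= odd_j odd_double.
rewrite [X in (X <= _)%N]mE !ltnS => ge_j; have j_eq : j = k.*2.
  by apply/eqP; rewrite eqn_leq ge_j andbT -2!ltnS -mE.
by have := up_neq (vtx M j.+1); rewrite upE j_eq eqxx.
Qed.

Lemma winding_vtx1 (R : realType) (m : nat) (M : meander m) (p : realpt m) :
  (0 < m)%N -> vtx M 1 = Some p -> winding R M p = 0.
Proof.
move=> m_gt0 v1; rewrite ffunE -v1 index_itinerary //.
by case: m m_gt0 {M p v1}.
Qed.

Lemma winding_vtxS (R : realType) (m : nat) (M : meander m) (p q : realpt m)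
    (i : nat) :
  (0 < i)%N -> (i.+1 < m.*2)%N -> vtx M i = Some p -> vtx M i.+1 = Some q ->
  winding R M q =
    winding R M p + (if counterclockwise M i then pi else - pi).
Proof.
move=> i_gt0 lt_i vi vi1; rewrite !ffunE -vi -vi1 !index_itinerary ?(ltnW lt_i) //.
by case: i i_gt0 {lt_i vi vi1}.
Qed.

Definition uniform (R : realType) (T : finType) : T -> R :=
  fun=> #|T|%:R^-1.

Definition Pr (R : realType) (T : finType) (mu : T -> R) (E : pred T) : R :=
  \sum_(w | E w) mu w.

Definition cond_Pr (R : realType) (T : finType) (mu : T -> R)
    (E F : pred T) : R :=
  Pr mu (predI E F) / Pr mu F.

(* Independence of X and Y under the conditional law given Z = c, for every
   value c that Z takes with positive probability. *)
Definition cond_independent (R : realType) (T : finType) (mu : T -> R)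
    (A B C : eqType) (X : T -> A) (Y : T -> B) (Z : T -> C) : Prop :=
  forall (SA : pred A) (SB : pred B) (c : C),
    0 < Pr mu [pred w | Z w == c] ->
    cond_Pr mu [pred w | SA (X w) && SB (Y w)] [pred w | Z w == c] =
      cond_Pr mu [pred w | SA (X w)] [pred w | Z w == c] *
      cond_Pr mu [pred w | SB (Y w)] [pred w | Z w == c].

(* Main.v *)
Require Import Defs.
From mathcomp Require Import all_boot all_order all_algebra.
From mathcomp Require Import reals trigo.

Set Implicit Arguments.
Unset Strict Implicit.
Unset Printing Implicit Defensive.

Import Order.TTheory GRing.Theory Num.Theory.
Local Open Scope ring_scope.

(** Given two meanders with the same winding function, gluing the
    upper diagram of one to the lower diagram of the other yields a meander, and
    this meander again has that winding function ([val_glue], [winding_glue]).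
    Hence the pairs of diagrams compatible with a fixed winding function form a
    product set, and the uniform law on a product set has independent
    coordinates.  The count is made by the involution that exchanges the lower
    halves of a pair of meanders ([cond_independent_uniform]).

    The point is that the glued diagrams form a single loop.  The winding
    function [theta] is a heading: along an arc above the line it drops by pi
    from the left end to the right end, and along an arc below it rises by pi,
    whatever the direction of travel.  This condition bears on each diagram
    separately, so it survives the gluing.  A component avoiding infinity would
    be a closed curve whose heading returns to its initial value, whereas the
    total turning of a simple closed curve is 2 pi or -2 pi.

    This last fact is proved for all the components avoiding infinity together,
    by recording only the word of headings read from left to right on the line.
    Removing innermost arcs, the lower diagram reduces this word to the empty
    one by deleting factors (a, a + pi), the upper diagram by deleting factors
    (a, a - pi) ([noncrossing_reducible]), and only the empty word admits both
    reductions ([reducible_opp_nil]).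

    Finally the orientation is a function of theta: the curve crosses the line
    upwards exactly where cos theta = 1.  So each oriented diagram is determined
    by the diagram and theta ([oriented_upperE], [oriented_lowerE]), which is
    why gluing preserves it. *)

(** * Words of headings *)

(** Words that can be erased by deleting factors [(a, a + e)]: each pair is an
    innermost arc of a diagram, [a] being the heading at its left end. *)
Inductive reducible (V : zmodType) (e : V) : seq V -> Prop :=
| Reducible_nil : reducible e [::]
| Reducible_insert p q a :
    reducible e (p ++ q) -> reducible e (p ++ [:: a, a + e & q]).

Lemma eq_cat_cat (T : Type) (p1 s1 p2 s2 : seq T) :
  p1 ++ s1 = p2 ++ s2 ->
  exists r, (p2 = p1 ++ r /\ s1 = r ++ s2) \/ (p1 = p2 ++ r /\ s2 = r ++ s1).
Proof.
elim: p1 p2 => [|x p1 IHp] [|y p2] /=.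
- by move=> ->; exists [::]; left.
- by move=> ->; exists (y :: p2); left.
- by move=> <-; exists (x :: p1); right.
by case=> -> /IHp[r [[-> ->]|[-> ->]]]; exists r; [left | right].
Qed.

Lemma subr_neq_addr (V : zmodType) (e b : V) : e + e != 0 -> b - e <> b + e.
Proof.
move=> e2_neq0 /eqP; rewrite eq_sym -subr_eq0 opprB [e - b]addrC addrACA subrr.
by rewrite add0r (negPf e2_neq0).
Qed.

(** This is the surgery that erases an innermost arc on the other side of the
    line.  If the factor [(a, a - e)] overlaps the pair deleted first by the
    given reduction, then the two cover x, x + e, x or x, x - e, x, and deleting
    either pair leaves a single letter x there; otherwise the two deletions
    commute.  The two pairs cannot coincide because [e + e] is nonzero. *)
Lemma reducible_delete_opp (V : zmodType) (e a : V) (p q : seq V) :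
  e + e != 0 -> reducible e (p ++ [:: a, a - e & q]) -> reducible e (p ++ q).
Proof.
move=> e2_neq0; move def_w: (p ++ _) => w red_w.
elim: red_w p a q def_w => [|p' q' b red_pq IH] p a q; first by case: p.
(* Two factors of the same word are compared by the distance between them:
   0 (same place), 1 (overlap), at least 2 (disjoint). *)
move/eq_cat_cat=> [[|x [|y r]] [[p_eq /= []]|[p_eq /= []]]].
- by move=> -> /(subr_neq_addr e2_neq0).
- by move=> -> /esym /(subr_neq_addr e2_neq0).
- by move=> x_eq b_eq ->; move: red_pq; rewrite p_eq -x_eq -b_eq subrK -catA.
- move=> x_eq a_eq q'_eq; move: red_pq.
  by rewrite q'_eq p_eq -x_eq -a_eq addrK -catA.
- move=> x_eq y_eq ->; rewrite catA; apply: Reducible_insert.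
  by rewrite -catA; apply: (IH _ a); rewrite p_eq -x_eq -y_eq -catA.
- move=> x_eq y_eq q'_eq; rewrite p_eq -catA -x_eq -y_eq.
  by apply: Reducible_insert; rewrite catA; apply: (IH _ a); rewrite q'_eq -catA.
Qed.

(** A word form of the theorem on the turning of simple closed curves.  Erasing
    upper arcs one at a time keeps the word erasable from below, until a single
    pair is left, of the form (a, a + e) and (a, a - e) at once: two arcs with
    the same ends form a loop that does turn, since [e + e] is nonzero. *)
Lemma reducible_opp_nil (V : zmodType) (e : V) (w : seq V) :
  e + e != 0 -> reducible e w -> reducible (- e) w -> w = [::].
Proof.
move=> e2_neq0 red_w redN_w; elim: redN_w red_w => // p q a _ IH red_w.
have /IH := reducible_delete_opp e2_neq0 red_w.
case: p {IH} red_w => //= red_w q_nil; rewrite q_nil in red_w.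
move def_v: [:: a; a - e] red_w => v red_v; case: red_v def_v => // p q' b _.
by case: p => [[-> /(subr_neq_addr e2_neq0)]|x [|y [|z p]]].
Qed.

(** Induction on the number of points.  The leftmost right end [y] of an arc is
    preceded by a left end [z], and [z] is joined to [y]: otherwise the arcs
    ending at [y] and starting at [z] would cross.  Deleting this adjacent pair
    leaves a noncrossing matching. *)
Lemma noncrossing_reducible (T : eqType) (V : zmodType) (rk : T -> nat)
    (d : T -> T) (f : T -> V) (e : V) (s : seq T) :
  injective rk -> sorted (relpre rk ltn) s ->
  {in s, forall x, [/\ d x \in s, d (d x) = x & d x != x]} ->
  {in s &, forall x y,
     ~~ [&& rk x < rk y, rk y < rk (d x) & rk (d x) < rk (d y)]%N} ->
  {in s, forall x, (rk x < rk (d x))%N -> f (d x) = f x + e} ->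
  reducible e (map f s).
Proof.
move=> rk_inj; have [n] := ubnP (size s).
elim: n s => // n IH s size_s srt match_s ncr turn.
have tr : transitive (relpre rk ltn) by move=> y x z; apply: ltn_trans.
have [->|[x0 x0_s]] : s = [::] \/ exists x, x \in s.
- case: s {size_s srt match_s ncr turn} => [|x s]; first by left.
  by right; exists x; rewrite mem_head.
- exact: Reducible_nil.
have rk_neq x : x \in s -> rk x != rk (d x).
  by case/match_s=> _ _ dx_neq; rewrite (inj_eq rk_inj) eq_sym.
have right_end : has (fun x => rk (d x) < rk x)%N s.
  have [dx_s dxK _] := match_s _ x0_s.
  have:= rk_neq _ x0_s; rewrite neq_ltn => /orP[lt_x|lt_dx]; apply/hasP.
    by exists (d x0); rewrite ?dxK.
  by exists x0.
have srt_pw : pairwise (relpre rk ltn) s by rewrite -sorted_pairwise.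
have [p [y [q [s_eq y_right p_left]]]] : exists p y q,
    [/\ s = p ++ y :: q, (rk (d y) < rk y)%N
      & {in p, forall x, (rk x < rk (d x))%N}].
- case def_s: _ _ _ / (split_find right_end) => [y p q y_right /hasPn p_left].
  exists p, y, q; split=> // [|x x_p]; first by rewrite cat_rcons.
  have x_s : x \in s by rewrite def_s mem_cat mem_rcons inE x_p orbT.
  by have := p_left x x_p; rewrite -leqNgt leq_eqVlt (negPf (rk_neq x x_s)).
have [dy_s dyK dy_neq] : [/\ d y \in s, d (d y) = y & d y != y].
  by apply: match_s; rewrite s_eq mem_cat mem_head orbT.
move: srt_pw; rewrite s_eq pairwise_cat allrel_consr /= => /and3P[].
case/andP=> /allP p_lt_y /allrelP p_lt_q pw_p /andP[/allP y_lt_q pw_q].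
have dy_p : d y \in p.
  move: dy_s; rewrite s_eq mem_cat inE (negPf dy_neq) /= => /orP[//|/y_lt_q] /=.
  by move=> /(ltn_trans y_right); rewrite ltnn.
case/lastP: p => [|p z] in s_eq p_left p_lt_y p_lt_q pw_p dy_p *; first by [].
have [dz_s dzK dz_neq] : [/\ d z \in s, d (d z) = z & d z != z].
  by apply: match_s; rewrite s_eq mem_cat mem_rcons mem_head.
have z_left : (rk z < rk (d z))%N by rewrite p_left // mem_rcons mem_head.
move: pw_p; rewrite pairwise_rcons => /andP[/allP p_lt_z pw_p].
have dzE : d z = y.
  apply/eqP; move: dz_s; rewrite s_eq mem_cat mem_rcons !inE (negPf dz_neq) /=.
  case/or3P=> [/p_lt_z /=|//|/y_lt_q /= y_lt_dz].
    by move=> /(ltn_trans z_left); rewrite ltnn.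
  move: dy_p; rewrite mem_rcons inE => /orP[/eqP <-|/p_lt_z /= dy_lt_z].
    by rewrite dyK.
  have z_lt_y : (rk z < rk y)%N by apply: p_lt_y; rewrite mem_rcons mem_head.
  have := ncr (d y) z dy_s.
  rewrite s_eq mem_cat mem_rcons mem_head dyK dy_lt_z z_lt_y y_lt_dz.
  by move/(_ isT).
rewrite cat_rcons map_cat /= -dzE turn //; last first.
  by rewrite s_eq mem_cat mem_rcons mem_head.
apply: Reducible_insert; rewrite -map_cat.
have sub x : x \in p ++ q -> x \in s.
  by rewrite s_eq cat_rcons !mem_cat !inE => /orP[] ->; rewrite ?orbT.
have [z_notin y_notin] : z \notin p ++ q /\ y \notin p ++ q.
  split; rewrite mem_cat; apply/norP; split; apply/negP.
  - by move/p_lt_z; rewrite /= ltnn.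
  - move=> z_q; have:= p_lt_q z z; rewrite mem_rcons mem_head z_q /= ltnn.
    by move=> /(_ isT isT).
  - move=> y_p; have:= p_lt_y y; rewrite mem_rcons inE y_p orbT /= ltnn.
    by move/(_ isT).
  - by move/y_lt_q; rewrite /= ltnn.
apply: IH.
- by move: size_s; rewrite s_eq cat_rcons !size_cat /= !addnS !ltnS => /ltnW.
- apply: (subseq_sorted tr _ srt); rewrite s_eq cat_rcons.
  apply: cat_subseq => //; apply: subseq_trans (subseq_cons _ z).
  exact: subseq_cons.
- move=> x x_pq; have [dx_s dxK dx_neq] := match_s x (sub x x_pq); split=> //.
  move: dx_s; rewrite s_eq cat_rcons !mem_cat !inE.
  case/or4P=> [->//|/eqP dx_z|/eqP dx_y|->].
  + by case/negP: y_notin; rewrite -dzE -dx_z dxK.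
  + by case/negP: z_notin; rewrite -dzK dzE -dx_y dxK.
  + by rewrite orbT.
- by move=> x x' /sub x_s /sub; apply: ncr.
- by move=> x /sub; apply: turn.
Qed.

(** * Closed components of a pair of arc diagrams *)

Lemma pos_inj (m : nat) : injective (@pos m).
Proof.
case=> [i|] [j|] //= eq_ij; first by rewrite (val_inj eq_ij).
  by have := ltn_ord i; rewrite eq_ij ltnn.
by have := ltn_ord j; rewrite -eq_ij ltnn.
Qed.

Lemma arc_diagramK (m : nat) (d : {ffun point m -> point m}) :
  arc_diagram d -> involutive d.
Proof. by case/andP=> /forallP pm _ x; have /andP[_ /eqP] := pm x. Qed.

Lemma arc_diagram_neq (m : nat) (d : {ffun point m -> point m}) (x : point m) :
  arc_diagram d -> d x != x.
Proof. by case/andP=> /forallP pm _; have /andP[] := pm x. Qed.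

(** The heading jumps by [e] from the left end to the right end of every arc
    of [d] with finite ends.  For a winding function [e] is [pi] below the line
    and [- pi] above it, and reversing the direction of travel along an arc does
    not change this condition. *)
Definition turning (V : zmodType) (m : nat) (d : {ffun point m -> point m})
    (e : V) (h : point m -> V) : Prop :=
  forall x, x != None -> d x != None -> (pos x < pos (d x))%N ->
    h (d x) = h x + e.

Lemma closed_arcs_reducible (V : zmodType) (m : nat)
    (d : {ffun point m -> point m}) (e : V) (h : point m -> V)
    (S : {set point m}) :
  arc_diagram d -> turning d e h -> None \notin S ->
  {in S, forall x, d x \in S} ->
  reducible e (map h (sort (relpre (@pos m) leq) (enum S))).
Proof.
move=> dP turn NS clS.
have sE x : (x \in sort (relpre (@pos m) leq) (enum S)) = (x \in S).
  by rewrite mem_sort mem_enum.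
have S_neq x : x \in S -> x != None by apply: contraTneq => ->.
apply: (noncrossing_reducible (rk := @pos m) (d := d)) => [|||x y _ _|x].
- exact: pos_inj.
- rewrite -sorted_map ltn_sorted_uniq_leq map_inj_uniq; last exact: pos_inj.
  rewrite sort_uniq enum_uniq sorted_map /=.
  by apply: sort_sorted => x y; apply: leq_total.
- move=> x; rewrite !sE => x_S.
  by rewrite clS // arc_diagramK // arc_diagram_neq.
- by case/andP: dP => _ /forallP/(_ x)/forallP/(_ y).
- by rewrite sE => x_S; apply: turn; rewrite S_neq ?clS.
Qed.

(** [S] is a union of components of the curve that avoid infinity.  Each of the
    two diagrams erases the word of headings of [S] in its own way, so this word
    is empty. *)
Lemma no_closed_arcs (V : zmodType) (m : nat)
    (up lo : {ffun point m -> point m}) (e : V) (h : point m -> V)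
    (S : {set point m}) :
  e + e != 0 -> arc_diagram up -> arc_diagram lo ->
  turning up (- e) h -> turning lo e h -> None \notin S ->
  {in S, forall x, up x \in S} -> {in S, forall x, lo x \in S} ->
  S = set0.
Proof.
move=> e2_neq0 upP loP turn_up turn_lo NS clU clL; apply/setP=> x.
have := reducible_opp_nil e2_neq0 (closed_arcs_reducible loP turn_lo NS clL)
  (closed_arcs_reducible upP turn_up NS clU).
move/(congr1 size); rewrite size_map size_sort -cardE => /eqP.
by rewrite cards_eq0 => /eqP ->.
Qed.

(** * Following the oriented curve *)

(** [c x] says that the curve crosses the line upwards at [x], so that it
    continues along an arc above the line.  Thanks to [c] the next point depends
    on the current point only, not on the number of steps made so far, and the
    itinerary becomes an orbit. *)
Definition advance (m : nat) (up lo : {ffun point m -> point m})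
    (c : pred (point m)) (x : point m) : point m :=
  if c x then up x else lo x.

(** An arc above or below the line joins an upward crossing to a downward one. *)
Definition switching (m : nat) (d : {ffun point m -> point m})
    (c : pred (point m)) : Prop := forall x, c (d x) = ~~ c x.

Section Advance.

Variables (m : nat) (up lo : {ffun point m -> point m}) (c : pred (point m)).
Hypotheses (upP : arc_diagram up) (loP : arc_diagram lo).
Hypotheses (c_up : switching up c) (c_lo : switching lo c).

Lemma visit_advance i :
  ~~ c None -> visit up lo i = iter i (advance up lo c) None.
Proof.
move=> cN.
have c_visit j : c (visit up lo j) = odd j.
  elim: j => [|j IH] /=; first exact: negbTE.
  by case: ifP => odd_j; rewrite ?c_up ?c_lo IH odd_j.
by elim: i => //= i <-; rewrite /advance c_visit; case: ifP.
Qed.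

Lemma advance_inj : injective (advance up lo c).
Proof.
apply: (can_inj (g := fun x => if c x then lo x else up x)) => x.
rewrite /advance; case: (boolP (c x)) => cx.
  by rewrite c_up cx arc_diagramK.
by rewrite c_lo cx arc_diagramK.
Qed.

Lemma fconnect_up x y :
  fconnect (advance up lo c) x (up y) = fconnect (advance up lo c) x y.
Proof.
have [cy|cy] := boolP (c y).
  by rewrite [RHS](same_fconnect1_r advance_inj) /advance cy.
by rewrite (same_fconnect1_r advance_inj) /advance c_up cy arc_diagramK.
Qed.

Lemma fconnect_lo x y :
  fconnect (advance up lo c) x (lo y) = fconnect (advance up lo c) x y.
Proof.
have [cy|cy] := boolP (c y).
  by rewrite (same_fconnect1_r advance_inj) /advance c_lo cy arc_diagramK.
by rewrite [RHS](same_fconnect1_r advance_inj) /advance (negPf cy).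
Qed.

(** The points outside the orbit of infinity under [advance] form a set closed
    under both diagrams, hence an empty one by [no_closed_arcs].  The orbit has
    at most [m.*2] elements, so it is exhausted by the itinerary. *)
Lemma turning_single_loop (V : zmodType) (e : V) (h : point m -> V) :
  (0 < m)%N -> e + e != 0 -> turning up (- e) h -> turning lo e h ->
  ~~ c None -> single_loop up lo.
Proof.
move=> m_gt0 e2_neq0 turn_up turn_lo cN; set g := advance up lo c.
have S0 : [set x | ~~ fconnect g None x] = set0.
  apply: (no_closed_arcs e2_neq0 upP loP turn_up turn_lo) => [|x|x].
  - by rewrite inE negbK connect0.
  - by rewrite !inE fconnect_up.
  - by rewrite !inE fconnect_lo.
apply/forallP=> x.
have x_conn : fconnect g None x.
  by have /setP/(_ x) := S0; rewrite !inE => /negbFE.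
rewrite -(iter_findex x_conn) -visit_advance //; apply: map_f.
rewrite mem_iota /= add0n; apply: (leq_trans (findex_max x_conn)).
apply: (leq_trans (max_card _)).
by rewrite card_option card_ord prednK ?double_gt0.
Qed.

End Advance.

(** * Arcs of a meander *)

Section MeanderArcs.

Variables (m : nat) (m_gt0 : (0 < m)%N) (M : meander m).

Lemma upper_arc_diagram : arc_diagram (upper M).
Proof. by have /and3P[] := valP M. Qed.

Lemma lower_arc_diagram : arc_diagram (lower M).
Proof. by have /and3P[] := valP M. Qed.

Lemma vtxS i : vtx M i.+1 = (if odd i then upper M else lower M) (vtx M i).
Proof. by []. Qed.

Lemma vtxP x : exists2 i, (i < m.*2)%N & x = vtx M i.
Proof.
have /and3P[_ _ /forallP/(_ x)/mapP[i]] := valP M.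
by rewrite mem_iota; exists i.
Qed.

(** The arc above the line at [x] is traversed between two consecutive visits,
    in one of the two directions; the last one, [i = m.*2.-1], returns to
    infinity. *)
Lemma upper_arcP x : exists2 i, (i < m.*2)%N && odd i &
  x = vtx M i /\ upper M x = vtx M i.+1 \/ x = vtx M i.+1 /\ upper M x = vtx M i.
Proof.
have [i lt_i ->] := vtxP x.
have [odd_i|even_i] := boolP (odd i).
  by exists i; rewrite ?lt_i // vtxS odd_i; left.
have [j [lt_j odd_j ->]] :
    exists j, [/\ (j < m.*2)%N, odd j & vtx M i = vtx M j.+1].
  case: i even_i lt_i => [|i] even_i lt_i.
    exists m.*2.-1; rewrite prednK ?double_gt0 // vtx_last //.
    by split=> //; case: (m) m_gt0 => //= k _; rewrite odd_double.
  by exists i; rewrite (ltnW lt_i) -[odd i]negbK.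
exists j; rewrite ?lt_j //; right; split=> //.
by rewrite vtxS odd_j (arc_diagramK upper_arc_diagram).
Qed.

Lemma lower_arcP x : exists2 i, (i.+1 < m.*2)%N && ~~ odd i &
  x = vtx M i /\ lower M x = vtx M i.+1 \/ x = vtx M i.+1 /\ lower M x = vtx M i.
Proof.
have [i lt_i ->] := vtxP x.
have [odd_i|even_i] := boolP (odd i); last first.
  exists i; last by rewrite vtxS (negPf even_i); left.
  rewrite even_i andbT ltn_neqAle lt_i andbT.
  by apply: contraNneq even_i => /(congr1 odd)/=; rewrite odd_double => /negbFE.
case: i odd_i lt_i => // i /= even_i lt_i; exists i; first by rewrite lt_i.
by right; rewrite vtxS (negPf even_i) (arc_diagramK lower_arc_diagram).
Qed.

End MeanderArcs.

(** * Headings and orientation of a meander *)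

(** At infinity the value is [pi], where the cosine is -1: the curve leaves
    infinity into the lower half-plane, as it does at a downward crossing. *)
Definition heading (R : realType) (m : nat) (theta : {ffun realpt m -> R})
    (x : point m) : R := if x is Some p then theta p else pi.

(** The heading at the i-th point is congruent to [(i - 1) * pi] modulo
    [2 * pi], so its cosine tells the parity of [i]. *)
Definition upward (R : realType) (m : nat) (theta : {ffun realpt m -> R})
    : pred (point m) := fun x => cos (heading theta x) == 1.

Section MeanderHeading.

Variables (R : realType) (m : nat) (m_gt0 : (0 < m)%N) (M : meander m).
Let h := heading (winding R M).

Lemma vtx_neq0 i : (0 < i)%N -> (i < m.*2)%N -> vtx M i != None.
Proof.
move=> i_gt0 lt_i; apply/eqP => vi.
have /(@vtx_inj m M i 0 lt_i) : vtx M i = vtx M 0 by rewrite vi.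
by rewrite double_gt0 => /(_ m_gt0) i0; rewrite i0 in i_gt0.
Qed.

Lemma heading_lower_infty : h (lower M None) = 0.
Proof.
have -> : lower M None = vtx M 1 by [].
have := @vtx_neq0 1 isT; case v1: (vtx M 1) => [p|].
  by rewrite /h /= (winding_vtx1 _ m_gt0 v1).
by move=> /(_ _)/eqP; case; case: (m) m_gt0.
Qed.

Lemma heading_vtxS i : (0 < i)%N -> (i.+1 < m.*2)%N ->
  h (vtx M i.+1) = h (vtx M i) + (if counterclockwise M i then pi else - pi).
Proof.
move=> i_gt0 lt_i.
have := vtx_neq0 i_gt0 (ltnW lt_i); have := @vtx_neq0 i.+1 isT lt_i.
case vi1: (vtx M i.+1) => [q|] // _; case vi: (vtx M i) => [p|] // _.
exact: winding_vtxS i_gt0 lt_i vi vi1.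
Qed.

Lemma turning_upper : turning (upper M) (- pi) h.
Proof.
move=> x x_fin ux_fin lt_x.
have [i /andP[lt_i odd_i] arc_x] := upper_arcP m_gt0 M x.
have i_gt0 : (0 < i)%N by case: (i) odd_i.
have lt_i1 : (i.+1 < m.*2)%N.
  rewrite ltn_neqAle lt_i andbT; apply: contraTneq isT => i1_last.
  case: arc_x => [[_ ux]|[x_eq _]].
    by move: ux_fin; rewrite ux i1_last vtx_last ?eqxx.
  by move: x_fin; rewrite x_eq i1_last vtx_last ?eqxx.
have := heading_vtxS i_gt0 lt_i1; rewrite /counterclockwise odd_i.
case: arc_x lt_x => [[-> ->]|[-> ->]] lt_x ->; last by rewrite lt_x addrK.
by rewrite ltnNge (ltnW lt_x).
Qed.

Lemma turning_lower : turning (lower M) pi h.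
Proof.
move=> x x_fin lx_fin lt_x.
have [i /andP[lt_i even_i] arc_x] := lower_arcP M x.
have i_gt0 : (0 < i)%N.
  rewrite lt0n; apply: contraTneq isT => i0; rewrite i0 in arc_x.
  by case: arc_x x_fin lx_fin => [[-> _]|[_ ->]].
have := heading_vtxS i_gt0 lt_i; rewrite /counterclockwise (negPf even_i).
case: arc_x lt_x => [[-> ->]|[-> ->]] lt_x ->; first by rewrite lt_x.
by rewrite ltnNge (ltnW lt_x) /= addrNK.
Qed.

Lemma cos_heading i : (i < m.*2)%N -> cos (h (vtx M i)) = (-1) ^+ i.+1.
Proof.
elim: i => [|[|i] IH] lt_i; first by rewrite /h /= cospi expr1.
  by rewrite heading_lower_infty cos0 expr2 mulrNN mulr1.
rewrite heading_vtxS // exprS mulN1r -IH 1?ltnW //.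
by case: ifP => _; rewrite ?cosDpi // cosB cospi sinpi mulr0 addr0 mulrN1.
Qed.

Lemma upward_vtx i : (i <= m.*2)%N -> upward (winding R M) (vtx M i) = odd i.
Proof.
have m1_eq1 : (-1 == 1 :> R) = false by exact: lt_eqF (lt_trans (ltrN10 R) ltr01).
rewrite leq_eqVlt => /orP[/eqP ->|lt_i].
  by rewrite vtx_last // /upward /= cospi odd_double m1_eq1.
rewrite /upward cos_heading // -signr_odd /=.
by case: (odd i); rewrite /= ?expr0 ?eqxx ?expr1.
Qed.

Lemma switching_upper : switching (upper M) (upward (winding R M)).
Proof.
move=> x; have [i /andP[lt_i odd_i]] := upper_arcP m_gt0 M x.
by case=> [[-> ->]|[-> ->]]; rewrite !upward_vtx ?(ltnW lt_i) //= odd_i.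
Qed.

Lemma switching_lower : switching (lower M) (upward (winding R M)).
Proof.
move=> x; have [i /andP[lt_i even_i]] := lower_arcP M x.
have le_i : (i <= m.*2)%N by rewrite ltnW // ltnW.
by case=> [[-> ->]|[-> ->]]; rewrite !upward_vtx ?(ltnW lt_i) //= (negPf even_i).
Qed.

Lemma oriented_upperE :
  oriented_upper M =
    [set (x, upper M x) | x in [pred x | upward (winding R M) x]].
Proof.
apply/setP=> a; apply/imsetP/imsetP => [[i + ->]|[x up_x ->]].
  rewrite inE => odd_i.
  exists (vtx M i); last by rewrite vtxS odd_i.
  by rewrite inE upward_vtx // ltnW.
have [i lt_i x_eq] := vtxP M x.
have odd_i : odd i by rewrite -(upward_vtx (ltnW lt_i)) -x_eq.
exists (Ordinal lt_i); first by rewrite inE.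
by rewrite x_eq vtxS /= odd_i.
Qed.

Lemma oriented_lowerE :
  oriented_lower M =
    [set (x, lower M x) | x in [pred x | ~~ upward (winding R M) x]].
Proof.
apply/setP=> a; apply/imsetP/imsetP => [[i + ->]|[x down_x ->]].
  rewrite inE => even_i.
  exists (vtx M i); last by rewrite vtxS (negPf even_i).
  by rewrite inE upward_vtx // ltnW.
have [i lt_i x_eq] := vtxP M x.
have even_i : ~~ odd i by rewrite -(upward_vtx (ltnW lt_i)) -x_eq.
exists (Ordinal lt_i); first by rewrite inE.
by rewrite x_eq vtxS /= (negPf even_i).
Qed.

End MeanderHeading.

(** * Gluing two meanders with the same winding function *)

Section Glue.

Variables (R : realType) (m : nat) (m_gt0 : (0 < m)%N).
Implicit Types M N : meander m.

(** The value [M1] is a default for the pairs of diagrams that do not form a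
    meander; by [val_glue], equal windings rule out such pairs. *)
Definition glue M1 M2 : meander m := insubd M1 (upper M1, lower M2).

Lemma pi2_neq0 : (pi + pi : R) != 0.
Proof. by rewrite gt_eqF // addr_gt0 ?pi_gt0. Qed.

(** The hypotheses of [turning_single_loop] concern one diagram at a time: they
    hold for the upper diagram because of [M1] and for the lower one because of
    [M2], with the same heading function. *)
Lemma val_glue M1 M2 :
  winding R M1 = winding R M2 -> val (glue M1 M2) = (upper M1, lower M2).
Proof.
move=> eq_w; rewrite val_insubd /= upper_arc_diagram lower_arc_diagram /=.
rewrite (turning_single_loop (c := upward (winding R M1))
  (h := heading (winding R M1)) _ _ _ _ m_gt0 pi2_neq0) //.
- exact: upper_arc_diagram.
- exact: lower_arc_diagram.
- exact: switching_upper.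
- by rewrite eq_w; apply: switching_lower.
- exact: turning_upper.
- by rewrite eq_w; apply: turning_lower.
by have := upward_vtx R m_gt0 M1 (leq0n _) => /= ->.
Qed.

Lemma upper_glue M1 M2 :
  winding R M1 = winding R M2 -> upper (glue M1 M2) = upper M1.
Proof. by move=> eq_w; rewrite /upper val_glue. Qed.

Lemma lower_glue M1 M2 :
  winding R M1 = winding R M2 -> lower (glue M1 M2) = lower M2.
Proof. by move=> eq_w; rewrite /lower val_glue. Qed.

(** The difference of two headings is constant along each arc, since both jump
    by the same amount. *)
Lemma turning_diff (V : zmodType) (d : {ffun point m -> point m}) (e : V)
    (h h' : point m -> V) (x : point m) :
  arc_diagram d -> turning d e h -> turning d e h' ->
  x != None -> d x != None -> h x = h' x -> h (d x) = h' (d x).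
Proof.
move=> dP turn turn' x_fin dx_fin eq_x.
have: pos x != pos (d x) by rewrite (inj_eq (@pos_inj m)) eq_sym arc_diagram_neq.
rewrite neq_ltn => /orP[lt_x|gt_x]; first by rewrite turn // turn' // eq_x.
apply: (addIr e); have dK := arc_diagramK dP.
have := turn (d x); have := turn' (d x); rewrite !dK => <- // <- //.
Qed.

(** A heading is determined along the curve by its value 0 at the first point
    [lower N None] and its jumps, so the two conditions on the diagrams
    characterize the winding function. *)
Lemma winding_uniq N (theta : {ffun realpt m -> R}) :
  turning (upper N) (- pi) (heading theta) ->
  turning (lower N) pi (heading theta) ->
  heading theta (lower N None) = 0 -> winding R N = theta.
Proof.
move=> turn_up turn_lo theta1.
suff eq_h x : heading (winding R N) x = heading theta x.
  by apply/ffunP=> p; apply: (eq_h (Some p)).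
have [i lt_i ->] := vtxP N x; elim: i lt_i => // i IH lt_i.
move: (IH (ltnW lt_i)) (@vtx_neq0 _ m_gt0 N _ (ltn0Sn i) lt_i).
case: (posnP i) => [-> _ _|i_gt0]; first by rewrite [LHS]heading_lower_infty.
have := @vtx_neq0 _ m_gt0 N i i_gt0 (ltnW lt_i); rewrite vtxS.
case: ifP => _ v_fin eq_v v1_fin.
  exact: turning_diff (upper_arc_diagram N) (@turning_upper R m m_gt0 N) turn_up
    v_fin v1_fin eq_v.
exact: turning_diff (lower_arc_diagram N) (@turning_lower R m m_gt0 N) turn_lo
  v_fin v1_fin eq_v.
Qed.

Lemma winding_glue M1 M2 :
  winding R M1 = winding R M2 -> winding R (glue M1 M2) = winding R M1.
Proof.
move=> eq_w; apply: winding_uniq; rewrite ?upper_glue ?lower_glue //.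
- exact: turning_upper.
- by rewrite eq_w; apply: turning_lower.
- by rewrite eq_w; apply: heading_lower_infty.
Qed.

Lemma oriented_upper_glue M1 M2 :
  winding R M1 = winding R M2 -> oriented_upper (glue M1 M2) = oriented_upper M1.
Proof.
by move=> eq_w; rewrite !(oriented_upperE R) // winding_glue // upper_glue.
Qed.

Lemma oriented_lower_glue M1 M2 :
  winding R M1 = winding R M2 -> oriented_lower (glue M1 M2) = oriented_lower M2.
Proof.
by move=> eq_w; rewrite !(oriented_lowerE R) // winding_glue // lower_glue // eq_w.
Qed.

Lemma glueK M1 M2 :
  winding R M1 = winding R M2 -> glue (glue M1 M2) (glue M2 M1) = M1.
Proof.
move=> eq_w; apply: val_inj.
rewrite val_glue ?winding_glue // upper_glue // lower_glue //.
by rewrite /upper /lower -surjective_pairing.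
Qed.

End Glue.

(** * Conditional independence under a uniform law *)

Lemma Pr_uniform (R : realType) (T : finType) (E : pred T) :
  Pr (uniform R (T := T)) E = #|E|%:R / #|T|%:R.
Proof. by rewrite /Pr /uniform sumr_const mulr_natl. Qed.

Lemma cond_Pr_uniform (R : realType) (T : finType) (E F : pred T) :
  cond_Pr (uniform R (T := T)) E F = #|predI E F|%:R / #|F|%:R.
Proof.
rewrite /cond_Pr !Pr_uniform; have [T0|T_neq0] := eqVneq (#|T|%:R : R) 0.
  have leT (G : pred T) : #|G|%:R = 0 :> R.
    apply/eqP; move/eqP: T0; rewrite !pnatr_eq0 -!leqn0.
    by apply: leq_trans; apply: max_card.
  by rewrite !leT !mul0r.
by rewrite invf_div mulrA divfK.
Qed.

(** [g a b] keeps the value of [X] at [a] and the value of [Y] at [b], within a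
    fibre of [Z]; the last hypothesis makes [(a, b) |-> (g a b, g b a)] an
    involution on pairs of points of one fibre [F].  It exchanges the pairs with
    [SA (X a)] and [SB (Y a)] with those with [SA (X a)] and [SB (Y b)], so the
    product of the two conditional probabilities is the joint one. *)
Lemma cond_independent_uniform (R : realType) (T : finType) (A B C : eqType)
    (X : T -> A) (Y : T -> B) (Z : T -> C) (g : T -> T -> T) :
  (forall a b, Z a = Z b -> X (g a b) = X a) ->
  (forall a b, Z a = Z b -> Y (g a b) = Y b) ->
  (forall a b, Z a = Z b -> Z (g a b) = Z a) ->
  (forall a b, Z a = Z b -> g (g a b) (g b a) = a) ->
  cond_independent (uniform R (T := T)) X Y Z.
Proof.
move=> Xg Yg Zg gK SA SB c F_gt0; rewrite !cond_Pr_uniform.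
set F := [pred w | Z w == c].
have F_neq0 : #|F|%:R != 0 :> R.
  apply: contraTneq F_gt0 => F0.
  by rewrite Pr_uniform F0 mul0r ltxx.
set AB := predI _ F; set AF := predI _ F; set BF := predI _ F.
(* Off the fibre product, [swap] is the identity, so as to be an involution of
   the whole of [T * T]. *)
pose swap (u : T * T) :=
  if Z u.1 == Z u.2 then (g u.1 u.2, g u.2 u.1) else u.
have swapK : involutive swap.
  case=> a b; rewrite /swap /=.
  have [eq_ab|/negPf ne_ab] := eqVneq (Z a) (Z b); last by rewrite /= ne_ab.
  by rewrite /= !Zg // eq_ab eqxx !gK.
have card_eq : (#|AB| * #|F| = #|AF| * #|BF|)%N.
  rewrite -!cardX -(card_image (inv_inj swapK)); apply: eq_card => u.
  rewrite -[u in LHS]swapK (mem_image (inv_inj swapK)) /swap.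
  case: u => a b /=; rewrite !inE /=.
  case: eqP => [eq_ab|ne_ab] /=.
    have eq_ba := esym eq_ab.
    rewrite /AB /AF /BF /F /= Xg // Yg // !Zg // eq_ab.
    by case: (Z b == c); rewrite ?andbF ?andbT.
  rewrite /AB /AF /BF /F /=.
  have [Za|_] := eqVneq (Z a) c; have [Zb|_] := eqVneq (Z b) c; rewrite ?andbF //.
  by case: ne_ab; rewrite Za Zb.
by rewrite mulf_div -natrM -card_eq natrM -mulf_div divff // mulr1.
Qed.

Theorem propositionB1 (R : realType) (m : nat) (hm : (1 <= m)%N) :
  cond_independent (@uniform R (meander m))
    (@oriented_upper m) (@oriented_lower m) (@winding R m).
Proof.
apply: (cond_independent_uniform (g := @glue m)) => M1 M2.
- exact: oriented_upper_glue.
- exact: oriented_lower_glue.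
- exact: winding_glue.
- exact: glueK.
Qed.
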